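(* Let $p\ge 2$, $q\ge 2$. An almost Grassmann structure $AG(p-1,p+q-1)$ on a manifold $M$ of dimension $pq$, regarded as a first-order $G$-structure with structure group $G=\mathbf{SL}(p)\times\mathbf{SL}(q)\times\mathbf{H}$, is a $G$-structure of finite type two.
   Context: Index ranges: $\alpha,\beta,\ldots=1,\dots,p$; $i,j,\ldots=p+1,\dots,p+q$; summation over repeated indices is understood; everything is real and smooth. Almost Grassmann structure: for $M$ of dimension $pq$, an almost Grassmann structure $AG(p-1,p+q-1)$ is a smooth field of Segre cones $SC_x(p,q)\subset T_x(M)$, $x\in M$. That is, locally there are smooth (adapted) frames $\{e_i^\alpha\}$ of $T_x(M)$ such that, writing $z=z^i_\alpha e_i^\alpha$, the cone $SC_x(p,q)$ consists of the vectors with $z_\alpha^i=t_\alpha s^i$ for some $t_\alpha,s^i\in\mathbf{R}$ (i.e. $\mathrm{rank}(z^i_\alpha)\le 1$). Adapted frames are related by $'e_i^\alpha=A_\beta^\alpha A_i^j e_j^\beta$ with $(A_\beta^\alpha)$, $(A_i^j)$ nonsingular of orders $p$ and $q$. Up to normalization this is the group $G=\mathbf{SL}(p)\times\mathbf{SL}(q)\times\mathbf{H}$, acting on $\mathbf{R}^{pq}$ ($p\times q$ arrays $z^i_\alpha$) by unimodular changes in each index together with the homotheties $\mathbf{H}=\mathbf{R}^*\otimes\mathrm{Id}$. The adapted frames thus make the structure a $G$-structure of first order. Finite type: for a Lie subalgebra $\mathfrak{g}\subset\mathfrak{gl}(V)$, the $k$-th prolongation $\mathfrak{g}^{(k)}$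 is the space of symmetric $(k+1)$-linear maps $T:V\times\cdots\times V\to V$ such that for all fixed $v_1,\dots,v_k$ the endomorphism $v\mapsto T(v,v_1,\dots,v_k)$ lies in $\mathfrak{g}$ (with $\mathfrak{g}^{(0)}=\mathfrak{g}$). A $G$-structure whose group has (linear) Lie algebra $\mathfrak{g}$ is of finite type $k$ if $\mathfrak{g}^{(k)}=0$ and $\mathfrak{g}^{(k-1)}\ne 0$. *)

(* Defs.v *)
From mathcomp Require Import all_boot all_order all_algebra all_fingroup.
From mathcomp Require Import all_classical all_reals all_analysis.

Set Implicit Arguments.
Unset Strict Implicit.
Unset Printing Implicit Defensive.

Import Order.TTheory GRing.Theory Num.Theory.
Import numFieldNormedType.Exports.

Local Open Scope classical_set_scope.
Local Open Scope ring_scope.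

Section Smooth.
Context {R : realType} {V W : normedModType R}.

(* [U] is meant to be open, so that continuity and differentiability at its
   points need not be relativized to [U]. *)
Fixpoint Ck_on (k : nat) (U : set V) (f : V -> W) : Prop :=
  match k with
  | 0 => forall x, U x -> {for x, continuous f}
  | k'.+1 => (forall x, U x -> differentiable f x) /\
             (forall v : V, Ck_on k' U (fun x => 'D_v f x))
  end.

Definition smooth_on (U : set V) (f : V -> W) : Prop := forall k, Ck_on k U f.

End Smooth.

Section Manifold.
Variables (R : realType) (n : nat) (M : topologicalType).

(* [param] is the inverse of [coord] on [coord @` dom]; the values of [coord]
   outside [dom] and of [param] outside [coord @` dom] are junk. *)
Record chart := Chart {
  dom : set M;
  coord : M -> 'rV[R]_n;
  param : 'rV[R]_n -> M;
  dom_open : open dom;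
  codom_open : open (coord @` dom);
  coordK : forall x, dom x -> param (coord x) = x;
  coord_continuous : forall x, dom x -> {for x, continuous coord};
  param_continuous :
    forall y, (coord @` dom) y -> {for y, continuous param}
}.

Definition transition (phi psi : chart) : 'rV[R]_n -> 'rV[R]_n :=
  coord psi \o param phi.

Record smooth_manifold := SmoothManifold {
  atlas : set chart;
  manifold_hausdorff : hausdorff_space M;
  manifold_second_countable : @second_countable M;
  atlas_cover : forall x, exists2 phi, atlas phi & dom phi x;
  atlas_compat : forall phi psi, atlas phi -> atlas psi ->
    smooth_on (coord phi @` (dom phi `&` dom psi)) (transition phi psi)
}.

Variable S : smooth_manifold.

Definition chart_at (x : M) : set chart :=
  [set phi | atlas S phi /\ dom phi x].

(* A tangent vector at [x] is the family of its components in the charts around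
   [x]; setting the components in all other charts to 0 makes the
   representation unique, so that [tangent_space x] is a copy of R^n inside
   the vector space of all functions [chart -> 'rV_n]. *)
Definition tvect := chart -> 'rV[R]_n.

Definition tangent_space (x : M) : set tvect :=
  [set v | (forall phi, ~ chart_at x phi -> v phi = 0) /\
           (forall phi psi, chart_at x phi -> chart_at x psi ->
              v psi = v phi *m jacobian (transition phi psi) (coord phi x))].

Definition smooth_vector_field (U : set M) (X : M -> tvect) : Prop :=
  (forall x, U x -> tangent_space x (X x)) /\
  (forall phi, atlas S phi ->
     smooth_on (coord phi @` (U `&` dom phi)) (fun y => X (param phi y) phi)).

Definition is_frame (x : M) (e : 'I_n -> tvect) : Prop :=
  (forall a, tangent_space x (e a)) /\
  (forall v, tangent_space x v ->
     exists! c : 'rV[R]_n, v = \sum_a c 0 a *: e a).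

Definition smooth_frame_field (U : set M) (e : M -> 'I_n -> tvect) : Prop :=
  (forall x, U x -> is_frame x (e x)) /\
  (forall a, smooth_vector_field U (fun x => e x a)).

(* The vector with row of components [z] in the frame [change_frame g e] has
   components [z *m g] in [e]; thus a linear group acts on R^n by right
   multiplication of row vectors. *)
Definition change_frame (g : 'M[R]_n) (e : 'I_n -> tvect) : 'I_n -> tvect :=
  fun a => \sum_b g a b *: e b.

Record G_structure (G : set 'M[R]_n) (U : set M) := GStructure {
  Gframes : M -> set ('I_n -> tvect);
  Gbase_open : open U;
  Gframes_frame : forall x e, U x -> Gframes x e -> is_frame x e;
  Gframes_orbit : forall x e, U x -> Gframes x e ->
    Gframes x = [set change_frame g e | g in G];
  Gframes_section : forall x, U x -> exists W : set M,
    [/\ open W, W x, W `<=` U & exists2 e : M -> 'I_n -> tvect,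
      smooth_frame_field W e & forall y, W y -> Gframes y (e y)]
}.

End Manifold.

Section FiniteType.
Variables (R : realType) (n : nat).

(* Tangent space at the identity of a linear Lie group. *)
Definition lie_algebra (G : set 'M[R]_n) : set 'M[R]_n :=
  [set X | exists eps : R, exists gamma : R -> 'M[R]_n,
     [/\ 0 < eps, smooth_on [set` `]- eps, eps[] gamma,
         forall t : R, t \in `]- eps, eps[ -> G (gamma t),
         gamma 0 = 1%:M & 'D_1 gamma 0 = X]].

Definition replace_at (k : nat) (v : 'I_k -> 'rV[R]_n) (i : 'I_k)
    (u : 'rV[R]_n) : 'I_k -> 'rV[R]_n :=
  fun j => if j == i then u else v j.

Definition multilinear (k : nat) (T : ('I_k -> 'rV[R]_n) -> 'rV[R]_n) : Prop :=
  forall (i : 'I_k) (v : 'I_k -> 'rV[R]_n) (a : R) (x y : 'rV[R]_n),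
    T (replace_at v i (a *: x + y)) = a *: T (replace_at v i x) + T (replace_at v i y).

Definition symmetric_map (k : nat) (T : ('I_k -> 'rV[R]_n) -> 'rV[R]_n) :
    Prop :=
  forall (s : 'S_k) (v : 'I_k -> 'rV[R]_n), T (v \o s) = T v.

(* The argument in position [ord0] varies, the entries of [v] in the [k] other
   positions are the fixed vectors; endomorphisms of R^n are matrices acting
   on row vectors from the right. *)
Definition prolongation (g : set 'M[R]_n) (k : nat) :
    set (('I_k.+1 -> 'rV[R]_n) -> 'rV[R]_n) :=
  [set T | [/\ multilinear T, symmetric_map T &
     forall v : 'I_k.+1 -> 'rV[R]_n,
       g (lin1_mx (fun u => T (replace_at v ord0 u)))]].
Arguments prolongation g k : clear implicits.

(* In type 0 there is no second condition: g^(-1) is not defined. *)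
Definition finite_type (g : set 'M[R]_n) (k : nat) : Prop :=
  prolongation g k = [set cst 0] /\
  (if k is j.+1 then prolongation g j <> [set cst 0] else True).

Definition G_structure_of_finite_type (M : topologicalType)
    (S : smooth_manifold R n M) (G : set 'M[R]_n) (U : set M)
    (P : G_structure S G U) (k : nat) : Prop :=
  finite_type (lie_algebra G) k.

End FiniteType.

Section AlmostGrassmann.
Variables (R : realType) (p q : nat) (M : topologicalType).
Variable S : smooth_manifold R (p * q) M.

Notation tvect := (tvect R (p * q) M).

(* A frame e_i^alpha is indexed by pairs through [mxvec_index], in the same way
   as [mxvec] flattens the p x q array z_alpha^i of components. *)
Definition segre_cone (e : 'I_(p * q) -> tvect) : set tvect :=
  [set z | exists (t : 'I_p -> R) (s : 'I_q -> R),
     z = \sum_alpha \sum_i (t alpha * s i) *: e (mxvec_index alpha i)].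

Definition adapted_frame (SC : M -> set tvect) (x : M)
    (e : 'I_(p * q) -> tvect) : Prop :=
  is_frame S x e /\ SC x = segre_cone e.

Record almost_grassmann := AlmostGrassmann {
  SC : M -> set tvect;
  SC_local : forall x, exists U : set M,
    [/\ open U, U x & exists2 e : M -> 'I_(p * q) -> tvect,
      smooth_frame_field S U e & forall y, U y -> adapted_frame SC y (e y)]
}.

End AlmostGrassmann.

(* SL(p) x SL(q) x H, as the group of matrices of its action
   z |-> c A z B on p x q arrays. *)
Definition SLSLH (R : realType) (p q : nat) : set 'M[R]_(p * q) :=
  [set g | exists (A : 'M[R]_p) (B : 'M[R]_q) (c : R),
     [/\ \det A = 1, \det B = 1, c != 0 &
         g = lin_mx (fun z : 'M[R]_(p, q) => c *: (A *m z *m B))]].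
Arguments SLSLH R p q : clear implicits.

(* [P] is [AG] regarded, over [U], as a first-order G-structure: its frames are
   adapted frames.  Since SL(p) x SL(q) x H can be smaller than the group of all
   changes of adapted frames (by signs of determinants when p or q is even, and
   by the transposition when p = q), such a [P] is a reduction that is not
   determined by [AG], always exists locally, and need not exist globally. *)
Definition underlies (R : realType) (p q : nat) (M : topologicalType)
    (S : smooth_manifold R (p * q) M) (AG : almost_grassmann S) (U : set M)
    (P : G_structure S (SLSLH R p q) U) : Prop :=
  forall x e, U x -> Gframes P x e -> adapted_frame S (SC AG) x e.

(* Main.v *)
Require Import Defs.
From HB Require Import structures.
From mathcomp Require Import all_boot all_order all_algebra all_fingroup.
From mathcomp Require Import all_classical all_reals all_analysis.
From mathcomp Require Import unstable ring lra.

(** Both claims come down to one fact: the maps z |-> c A z B with A in SL(p),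
    B in SL(q), c <> 0 form a group acting on p x q arrays that preserves
    arrays of rank at most 1.

    A local frame adapted to the cone field therefore has an orbit under
    SL(p) x SL(q) x H that consists of adapted frames, and the field of these
    orbits is an underlying G-structure ([underlying_G_structure]).

    The finite type depends only on the Lie algebra g of the group, of which
    two things are needed.

    - Every z |-> X z + z Y is in g ([segre_inf_lie_algebra]): it is the velocity
      of t |-> (1 + t X) z (1 + t Y), which stays in the group for small t since
      matrices of positive determinant are multiples of unimodular ones, and
      the multiples are absorbed by the homotheties. Hence, for every C, the
      symmetric map (z, w) |-> z C w + w C z is in g^(1), and g^(1) <> 0
      ([first_prolongation_SLSLH]).

    - An element of g maps a rank one array s t to a vector tangent to the cone
      at s t ([lie_algebra_tangent]): a curve in the group keeps the 2 x 2 minors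
      of the image of s t equal to zero, and these equations are differentiated
      at t = 0.

    The tangency conditions are linear in the matrix of the element, and on
    suitable s, t they give the relations [segre_coef] between its entries
    ([lie_algebra_coef]). A map T in g^(2) has these relations in each of its
    three arguments, and they leave no nonzero coefficient
    ([segre_coef_trilinear0]): if the entry (g, k) of T(e_a, e_b, e_c) is not
    zero, each argument must lie in row g or in column k; if an argument lies in
    only one of these lines, it can be moved to another parallel line together
    with the output entry, and then one of the other arguments violates this,
    except in one configuration, whose coefficient is seen to equal its own
    opposite. There remain the coefficients with all arguments at (g, k), which
    the diagonal relation expresses by those that vanish already. *)

Set Implicit Arguments.
Unset Strict Implicit.
Unset Printing Implicit Defensive.

Import Order.TTheory GRing.Theory Num.Theory.
Import numFieldNormedType.Exports.

Local Open Scope classical_set_scope.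
Local Open Scope ring_scope.

(** * Polynomial curves of matrices *)

Section PolynomialCurves.
Context {R : realType} {m n : nat}.

Definition poly_curve (P : 'M[{poly R}]_(m, n)) (t : R) : 'M[R]_(m, n) :=
  map_mx (horner_eval t) P.

Lemma poly_curve_differentiable P t : differentiable (poly_curve P) t.
Proof.
apply/derivable1_diffP/derivable_mxP => i j.
rewrite (_ : (fun x => _) = horner (P i j)); first exact: derivable_horner.
by apply/funext => x; rewrite mxE.
Qed.

(** Stated for every direction [v], because [Ck_on] iterates over all directional
    derivatives: the class of polynomial curves is stable under them. *)
Lemma derive_poly_curve P t v :
  'D_v (poly_curve P) t = poly_curve (\matrix_(i, j) (v%:P * (P i j)^`())) t.
Proof.
have dP := poly_curve_differentiable P t.
rewrite deriveE// -[v]mulr1 -[v * 1]/(v *: 1) linearZ/= -deriveE//.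
rewrite derive_mx; last exact/derivable1_diffP.
apply/matrixP => i j; rewrite !mxE /horner_eval.
rewrite scaler1 hornerM hornerC; congr (_ * _).
rewrite (_ : (fun x => _) = horner (P i j)); last first.
  by apply/funext => x; rewrite mxE.
by rewrite derive_val.
Qed.

Lemma smooth_poly_curve U P : smooth_on U (poly_curve P).
Proof.
move=> k; elim: k P => [|k IH] P /=.
  by move=> x _; exact/differentiable_continuous/poly_curve_differentiable.
split=> [x _|v]; first exact: poly_curve_differentiable.
rewrite (_ : (fun x => _) = poly_curve (\matrix_(i, j) (v%:P * (P i j)^`()))) //.
by apply/funext => x; exact: derive_poly_curve.
Qed.

End PolynomialCurves.

(** * The group SL(p) x SL(q) x H and its infinitesimal action *)

Lemma mulmx_rowP (R : pzSemiRingType) (m n : nat) (A B : 'M[R]_(m, n)) :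
  (forall u : 'rV_m, u *m A = u *m B) -> A = B.
Proof. by move=> AB; apply/row_matrixP => i; rewrite !rowE AB. Qed.

Section Action.
Context {R : realType} {p q : nat}.
Implicit Types (A : 'M[R]_p) (B : 'M[R]_q) (c : R).

Definition segre_act c A B (z : 'M[R]_(p, q)) := c *: (A *m z *m B).

Lemma segre_act_linear c A B : linear (segre_act c A B).
Proof.
move=> a x y; rewrite /segre_act mulmxDr mulmxDl -scalemxAr -scalemxAl.
by rewrite scalerDr !scalerA mulrC.
Qed.
HB.instance Definition _ c A B :=
  GRing.isLinear.Build R _ _ _ (segre_act c A B) (segre_act_linear c A B).

(** The velocity at t = 0 of t |-> (1 + t A) z (1 + t B). *)
Definition segre_inf A B (z : 'M[R]_(p, q)) := A *m z + z *m B.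

Lemma segre_inf_linear A B : linear (segre_inf A B).
Proof.
move=> a x y; rewrite /segre_inf mulmxDr mulmxDl -scalemxAr -scalemxAl.
by rewrite scalerDr addrACA.
Qed.
HB.instance Definition _ A B :=
  GRing.isLinear.Build R _ _ _ (segre_inf A B) (segre_inf_linear A B).

Lemma lin_mx_actM c c' A A' B B' :
  lin_mx (segre_act c A B) *m lin_mx (segre_act c' A' B') =
  lin_mx (segre_act (c * c') (A' *m A) (B *m B')).
Proof.
apply: mulmx_rowP => u; rewrite -(vec_mxK u) mulmxA !mul_vec_lin /=.
by rewrite /segre_act -scalemxAr -scalemxAl scalerA !mulmxA [c' * c]mulrC.
Qed.

Lemma lin_mx_act1 : lin_mx (segre_act 1 1%:M 1%:M) = 1%:M.
Proof.
apply: mulmx_rowP => u; rewrite -(vec_mxK u) mul_vec_lin /=.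
by rewrite /segre_act scale1r mul1mx !mulmx1.
Qed.

Lemma SLSLH1 : SLSLH R p q 1%:M.
Proof.
exists 1%:M, 1%:M, 1; split; rewrite ?det1 ?oner_eq0 //.
by rewrite -lin_mx_act1.
Qed.

Lemma SLSLHM g h : SLSLH R p q g -> SLSLH R p q h -> SLSLH R p q (g *m h).
Proof.
move=> [A [B [c [dA dB c0 ->]]]] [A' [B' [c' [dA' dB' c'0 ->]]]].
exists (A' *m A), (B *m B'), (c * c'); split; last exact: lin_mx_actM.
- by rewrite det_mulmx dA dA' mulr1.
- by rewrite det_mulmx dB dB' mulr1.
- by rewrite mulf_neq0.
Qed.

Lemma SLSLH_inv g : SLSLH R p q g ->
  exists h, [/\ SLSLH R p q h, g *m h = 1%:M & h *m g = 1%:M].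
Proof.
move=> [A [B [c [dA dB c0 ->]]]].
have uA : A \in unitmx by rewrite unitmxE dA unitr1.
have uB : B \in unitmx by rewrite unitmxE dB unitr1.
exists (lin_mx (segre_act c^-1 (invmx A) (invmx B))); split.
- exists (invmx A), (invmx B), c^-1.
  by split; rewrite ?det_inv ?dA ?dB ?invr1 ?invr_eq0.
- by rewrite [LHS]lin_mx_actM mulVmx // mulmxV // divff // lin_mx_act1.
- by rewrite [LHS]lin_mx_actM mulmxV // mulVmx // mulVf // lin_mx_act1.
Qed.

End Action.

(** * Velocities in the group *)

Lemma normalize_det (R : realType) (n : nat) (A : 'M[R]_n.+1) : 0 < \det A ->
  exists2 r : R, 0 < r & \det (r *: A) = 1.
Proof.
move=> dA; exists (\det A `^ (- n.+1%:R^-1)); first exact: powR_gt0.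
rewrite detZ -powR_mulrn ?powR_ge0// -powRrM mulNr mulVf ?pnatr_eq0//.
by rewrite powR_inv1 ?ltW// mulVf// gt_eqF.
Qed.

(** [A] and [B] are normalized by roots of their determinants, which cancel against
    the homothety factor; a curve of such actions is thus as smooth as [A] and
    [B], whatever the roots. *)
Lemma pos_det_SLSLH (R : realType) (p q : nat)
    (A : 'M[R]_p.+1) (B : 'M[R]_q.+1) :
  0 < \det A -> 0 < \det B -> SLSLH R p.+1 q.+1 (lin_mx (segre_act 1 A B)).
Proof.
move=> /normalize_det[r r0 rA] /normalize_det[s s0 sB].
exists (r *: A), (s *: B), (r * s)^-1; split=> //.
  by rewrite invr_eq0 mulf_neq0 ?gt_eqF.
congr lin_mx; apply/funext => z; rewrite /segre_act.
rewrite -!scalemxAl -!scalemxAr !scalerA -mulrA mulVf//.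
by rewrite mulf_neq0 ?gt_eqF.
Qed.

Lemma det_near1 (R : realType) (n : nat) (X : 'M[R]_n) :
  exists2 eps : R, 0 < eps &
    forall t : R, t \in `]- eps, eps[ -> 0 < \det (1%:M + t *: X).
Proof.
(* The determinant is a polynomial in t, hence continuous. *)
pose D : {poly R} := \det (1%:M + 'X *: map_mx polyC X).
have DE t : \det (1%:M + t *: X) = D.[t].
  rewrite -/(horner_eval t D) -det_map_mx; congr (\det _).
  apply/matrixP => i j; rewrite !mxE rmorphD rmorph_nat rmorphM /=.
  by rewrite /horner_eval hornerX hornerC.
have D0 : 0 < D.[0] by rewrite -DE scale0r addr0 det1.
have /cvgrPdist_lt/(_ _ D0) := @continuous_horner R D 0.
move=> /nbhs_ballP[e /= e0 De]; exists e => // t.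
rewrite in_itv/= => /andP[t1 t2]; rewrite DE.
have := De t; rewrite /ball/= sub0r normrN ltr_norml t1 t2 => /(_ isT).
by rewrite ltr_norml => /andP[_]; lra.
Qed.

(** The curve is t |-> (1 + t A) z (1 + t B); it is polynomial, hence smooth, and
    stays in the group as long as both determinants are positive. *)
Lemma segre_inf_lie_algebra (R : realType) (p q : nat)
    (A : 'M[R]_p.+1) (B : 'M[R]_q.+1) :
  lie_algebra (SLSLH R p.+1 q.+1) (lin_mx (segre_inf A B)).
Proof.
have [e1 e10 dA] := det_near1 A; have [e2 e20 dB] := det_near1 B.
pose N := (p.+1 * q.+1)%N.
pose L := lin_mx (segre_inf A B); pose Q := lin_mx (segre_act 1 A B).
pose P : 'M[{poly R}]_N := map_mx polyC 1%:M + 'X *: map_mx polyC L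
   + 'X^2 *: map_mx polyC Q.
have PE t : poly_curve P t = lin_mx (segre_act 1 (1%:M + t *: A) (1%:M + t *: B)).
  (* The quadratic term of (1 + t A) z (1 + t B) is t^2 A z B. *)
  have -> : poly_curve P t = 1%:M + t *: L + t ^+ 2 *: Q.
    by apply/matrixP => i j; rewrite !mxE /horner_eval !hornerE.
  apply: mulmx_rowP => u; rewrite -(vec_mxK u) mulmxDr mulmxDr -!scalemxAr.
  rewrite !mul_vec_lin mulmx1 -!linearZ -!linearD; congr mxvec => /=.
  rewrite /segre_act /segre_inf !scale1r; set z := vec_mx u.
  have vZ c : vec_mx (c *: u) = c *: z by rewrite linearZ.
  rewrite mulmxDr mulmx1 mulmxDl mul1mx -scalemxAl -scalemxAr mulmxDl.
  rewrite -scalemxAl !scalerDr scalerA -expr2 !addrA !vZ -!scalemxAr -!scalemxAl.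
  by [].
exists (Num.min e1 e2), (poly_curve P); split.
- by rewrite lt_min e10.
- exact: smooth_poly_curve.
- move=> t; rewrite in_itv/= PE => /andP[].
  rewrite ltrNl !lt_min => /andP[t1 t2] /andP[t3 t4].
  apply: pos_det_SLSLH; [apply: dA|apply: dB]; rewrite in_itv/=; lra.
- by rewrite PE !scale0r !addr0 lin_mx_act1.
- rewrite derive_poly_curve.
  apply/matrixP => i j; rewrite !mxE /horner_eval !poly.derivE.
  rewrite !(hornerE, hornerMn) /=.
  by rewrite !(mul0r, mul0rn, mulr0, expr0n, addr0, add0r, mul1r).
Qed.

(** * Tangency to the Segre cone *)

Lemma is_derive_scalar (R : realType) (m n : nat) (f : 'M[R]_(m, n) -> R)
    (g : R -> 'M[R]_(m, n)) (t v : R) : scalar f ->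
  derivable g t v -> is_derive t v (f \o g) (f ('D_v g t)).
Proof.
move=> flin dg.
have fE G : f G = \sum_i \sum_j f (delta_mx i j) *: G i j.
  pose F : {scalar 'M[R]_(m, n)} := HB.pack f
    (GRing.isLinear.Build R _ _ _ f flin).
  rewrite -[f]/(F : _ -> _) {1}[G]matrix_sum_delta linear_sum.
  apply: eq_bigr => i _; rewrite linear_sum; apply: eq_bigr => j _.
  by rewrite linearZ /= mulrC.
have -> : f \o g = \sum_i \sum_j (fun x => f (delta_mx i j) *: g x i j).
  apply/funext => x; rewrite /= fE fct_sumE; apply: eq_bigr => i _.
  by rewrite fct_sumE.
rewrite fE derive_mx//.
apply: is_derive_sum => i; apply: is_derive_sum => j; rewrite mxE.
apply: is_deriveZ; apply: derivableP.
exact: (derivable_mxP _ _ _).1.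
Qed.

(** The array (c A s) (t B), image of s t under an element of the group, has rank
    at most 1, so its minor on the rows [phi], [s^T] and the columns [psi],
    [t^T] vanishes. At the identity phi s = t psi = 0, so in the derivative of
    this 2 x 2 determinant only the term with the derivative of the entry
    (phi, psi) survives; its cofactor |s|^2 |t|^2 is nonzero. *)
Lemma lie_algebra_tangent (R : realType) (p q : nat) (X : 'M[R]_(p * q))
    (s : 'cV[R]_p) (t : 'rV[R]_q) (phi : 'rV[R]_p) (psi : 'cV[R]_q) :
  lie_algebra (SLSLH R p q) X -> phi *m s = 0 -> t *m psi = 0 ->
  phi *m vec_mx (mxvec (s *m t) *m X) *m psi = 0.
Proof.
move=> [eps [g [eps0 smooth_g Gg g0 DgX]]] phis tpsi.
pose f (a : 'rV[R]_p) (b : 'cV[R]_q) (G : 'M[R]_(p * q)) :=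
  (a *m vec_mx (mxvec (s *m t) *m G) *m b) 0 0.
have f_linear a b : scalar (f a b).
  move=> c G H; rewrite /f mulmxDr -scalemxAr linearP /= mulmxDr mulmxDl.
  by rewrite -scalemxAr -scalemxAl !mxE.
have dg : derivable g 0 1.
  apply/derivable1_diffP; apply: (smooth_g 1%N).1.
  by rewrite /= in_itv/= oppr_lt0 eps0.
have df a b : is_derive (0 : R) (1 : R) (f a b \o g) (f a b X).
  by rewrite -DgX; exact: is_derive_scalar.
have fg0 a b : f a b (g 0) = (a *m s) 0 0 * (t *m b) 0 0.
  by rewrite g0 /f mulmx1 mxvecK mulmxA -mulmxA mxE big_ord1.
pose a' := s^T; pose b' := t^T.
pose F a b : R -> R := f a b \o g.
have minor : \forall x \near (0 : R), (F phi psi * F a' b') x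
                          = (F phi b' * F a' psi) x.
  near=> x.
  have [A [B [c [_ _ _ gE]]]] : SLSLH R p q (g x).
    apply: Gg; near: x; apply: near_in_itvoo.
    by rewrite in_itv/= oppr_lt0 eps0.
  have fE a b : f a b (g x) = c * ((a *m A *m s) 0 0 * (t *m B *m b) 0 0).
    rewrite /f gE -[lin_mx _]/(lin_mx (segre_act c A B)) mul_vec_lin mxvecK.
    rewrite /segre_act -scalemxAr -scalemxAl mxE !mulmxA; congr (_ * _).
    have -> : a *m A *m s *m t *m B *m b = (a *m A *m s) *m (t *m B *m b).
      by rewrite !mulmxA.
    by rewrite mxE big_ord1.
  rewrite /F /= !fctE /= !fE; ring.
have sq0 (n : nat) (u : 'rV[R]_n) : (u *m u^T) 0 0 = 0 -> u = 0.
  rewrite mxE => /eqP; rewrite psumr_eq0 => [/allP u0|i _]; last first.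
    by rewrite mxE -expr2 sqr_ge0.
  apply/rowP => i; have := u0 i; rewrite mem_index_enum => /(_ isT).
  by rewrite !mxE mulf_eq0 orbb => /eqP.
have [a'0|a'0] := eqVneq ((a' *m s) 0 0) 0.
  have /(congr1 trmx) : s^T = 0 by apply: sq0; rewrite trmxK.
  rewrite trmxK trmx0 => ->.
  by rewrite mul0mx linear0 mul0mx linear0 mulmx0 mul0mx.
have [b'0|b'0] := eqVneq ((t *m b') 0 0) 0.
  have -> : t = 0 by apply: sq0.
  by rewrite mulmx0 linear0 mul0mx linear0 mulmx0 mul0mx.
have D1 := is_deriveM (df phi psi) (df a' b').
have D2 := is_deriveM (df phi b') (df a' psi).
have z00 : (0 : 'M[R]_1) 0 0 = 0 by rewrite mxE.
have := @near_eq_derive _ _ _ _ _ (0 : R) (1 : R) minor.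
rewrite (@derive_val _ _ _ _ _ _ _ D1) (@derive_val _ _ _ _ _ _ _ D2).
rewrite /= !fg0 phis tpsi !z00 !mul0r !mulr0 !scale0r add0r addr0.
move=> /eqP; rewrite scaler_eq0 mulf_eq0 (negbTE a'0) (negbTE b'0) /= => /eqP f0.
by apply/matrixP => i j; rewrite !ord1 -[LHS]/(f phi psi X) f0 mxE.
Unshelve. all: by end_near.
Qed.

(** * Trilinear maps with Segre coefficients *)

(** Entries of an endomorphism of p x q arrays that belongs to
    gl(p) (x) 1 + 1 (x) gl(q): x (a, i) (g, k) is the component (g, k) of the image
    of the array with a single 1 at (a, i). In the image X z + z Y of this array
    the four conditions say that the entries off row a and column i are zero, that
    X_ga does not depend on the column, that Y_ik does not depend on the row, and
    that the diagonal coefficients are sums X_aa + Y_ii. *)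
Definition segre_coef (I J : eqType) (R : zmodType) (x : I * J -> I * J -> R) :=
  [/\ forall a g i k, a != g -> i != k -> x (a, i) (g, k) = 0,
      forall a g k l, a != g -> x (a, k) (g, k) = x (a, l) (g, l),
      forall a b i k, i != k -> x (a, i) (a, k) = x (b, i) (b, k) &
      forall a b i k, x (a, i) (a, i) + x (b, k) (b, k) =
                      x (a, k) (a, k) + x (b, i) (b, i)].

Section Trilinear.
Variable R : numDomainType.

(** Transposition exchanges rows and columns, so that statements about rows yield
    those about columns. *)
Lemma segre_coef_swap (I J : eqType) (x : I * J -> I * J -> R) :
  segre_coef x -> segre_coef (fun a b => x (swap a) (swap b)).
Proof.
case=> h0 h1 h2 h3; split=> /= [a g i k ag ik|a g k l ag|a b i k ik|a b i k].
- exact: h0.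
- exact: h2.
- exact: h1.
- by rewrite h3 addrC.
Qed.

(** [T a b c d] is the component [d] of the value of a symmetric trilinear map on
    the basis arrays [a], [b], [c]. *)
Section Row.
Variables I J : eqType.
Hypotheses (I2 : forall a : I, exists b, b != a)
           (J2 : forall i : J, exists k, k != i).
Variable T : I * J -> I * J -> I * J -> I * J -> R.
Hypotheses (T12 : forall a b c d, T a b c d = T b a c d)
           (T23 : forall a b c d, T a b c d = T a c b d)
           (Tcoef : forall b c, segre_coef (fun a d => T a b c d)).

Let T13 a b c d : T a b c d = T c b a d. Proof. by rewrite T12 T23 T12. Qed.

Lemma segre_off1 a i g k b c : a != g -> i != k -> T (a, i) b c (g, k) = 0.
Proof. by case: (Tcoef b c) => h _ _ _; exact: h. Qed.
Lemma segre_off2 a i g k b c : a != g -> i != k -> T b (a, i) c (g, k) = 0.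
Proof. by rewrite T12; exact: segre_off1. Qed.
Lemma segre_off3 a i g k b c : a != g -> i != k -> T b c (a, i) (g, k) = 0.
Proof. by rewrite T13; exact: segre_off1. Qed.

Lemma segre_shift_row a g i k b c : i != k ->
  T (a, i) b c (a, k) = T (g, i) b c (g, k).
Proof. by case: (Tcoef b c) => _ _ h _; exact: h. Qed.
Lemma segre_shift_col a g i k b c : a != g ->
  T (a, i) b c (g, i) = T (a, k) b c (g, k).
Proof. by case: (Tcoef b c) => _ h _ _; exact: h. Qed.

(** The configuration that shifts alone do not exclude. The diagonal relation in the
    third argument, between the entries (g, k) and (a, i), has only two nonzero
    terms; two shifts, one along a row and one along a column, identify them, so
    that the coefficient is its own opposite. *)
Lemma segre_cross_eq0 a g i k : a != g -> i != k ->
  T (g, i) (a, k) (g, k) (g, k) = 0.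
Proof.
move=> ag ik; case: (Tcoef (g, i) (a, k)) => _ _ _ h.
have ga : g != a by rewrite eq_sym.
have ki : k != i by rewrite eq_sym.
have E u d : T u (g, i) (a, k) d = T (g, i) (a, k) u d by rewrite T12 T23.
have := h g a k i; rewrite !E.
rewrite [T (g, i) (a, k) (g, i) _]segre_off2//.
rewrite [T (g, i) (a, k) (a, k) _]segre_off1// addr0.
have -> : T (g, i) (a, k) (a, i) (a, i) = T (g, i) (a, k) (g, k) (g, k).
  by rewrite T12 (segre_shift_row _ g)// T13 (segre_shift_col _ k)//.
by move=> /eqP; rewrite -mulr2n mulrn_eq0 => /eqP.
Qed.

(** Here the first argument lies in the row of the output entry but not in its
    column, so the coefficient does not change when both move to another row [a].
    If it is not zero, an argument outside column [k] would have to lie in row [g]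
    and in row [a]; so the other two arguments are in column [k]. *)
Lemma segre_row_eq0 g i k b c : i != k -> T (g, i) b c (g, k) = 0.
Proof.
move=> ik; have [a ag] := I2 g; have [l lk] := J2 k.
wlog suff : b c / T (g, i) b c (g, k) != 0 -> b.2 = k.
  move=> H; have [//|nz] := eqVneq (T (g, i) b c (g, k)) 0.
  have := H _ _ nz; have := H c b; rewrite T23 nz => /(_ isT).
  case: b nz {H} => b1 b2; case: c => c1 c2 nz /= c2k b2k.
  rewrite {c2}c2k {b2}b2k in nz *.
  have [b1g|b1g] := eqVneq b1 g; last first.
    (* [b] is out of row [g], so it can be moved together with the output to
       column [l]; this excludes [c] unless [c] is in row [g]. *)
    have [c1g|c1g] := eqVneq c1 g; first by rewrite c1g segre_cross_eq0.
    rewrite T12 (segre_shift_col _ l)// T13 segre_off1//.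
    by rewrite eq_sym.
  have [c1g|c1g] := eqVneq c1 g; last by rewrite b1g T23 segre_cross_eq0.
  rewrite b1g c1g (segre_shift_row _ a)// T12 (segre_shift_col _ l) 1?eq_sym//.
  by rewrite segre_off3 // eq_sym.
case: b => b1 b2 /=; have [//|b2k] := eqVneq b2 k.
have [->|b1g] := eqVneq b1 g; last by rewrite segre_off2 ?eqxx.
rewrite (segre_shift_row _ a)// segre_off2 ?eqxx//.
by rewrite eq_sym.
Qed.

End Row.

(** By [segre_row_eq0] and its transpose, a coefficient vanishes unless each argument
    equals the output entry; the diagonal relation kills this last one. *)
Lemma segre_coef_trilinear0 (I J : eqType)
    (I2 : forall a : I, exists b, b != a) (J2 : forall i : J, exists k, k != i)
    (T : I * J -> I * J -> I * J -> I * J -> R) :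
  (forall a b c d, T a b c d = T b a c d) ->
  (forall a b c d, T a b c d = T a c b d) ->
  (forall b c, segre_coef (fun a d => T a b c d)) ->
  forall a b c d, T a b c d = 0.
Proof.
move=> T12 T23 Tcoef.
have row := segre_row_eq0 I2 J2 T12 T23 Tcoef.
have off g i a k b c : g != a -> i != k -> T (g, i) b c (a, k) = 0.
  by move=> ga ik; rewrite (segre_off1 Tcoef).
have col a i g b c : a != g -> T (a, i) b c (g, i) = 0.
  move=> ag.
  pose T' a b c d := T (swap a) (swap b) (swap c) (swap d).
  have -> : T (a, i) b c (g, i) = T' (i, a) (swap b) (swap c) (i, g).
    by case: b c => b1 b2 [c1 c2].
  apply: (@segre_row_eq0 _ _ J2 I2 T') => //.
  - by move=> *; exact: T12.
  - by move=> *; exact: T23.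
  - by move=> u v; exact: segre_coef_swap (Tcoef _ _).
have main a b c d : a <> d -> T a b c d = 0.
  case: a d => a i [g k] ad.
  have [ag|ag] := eqVneq a g; have [ik|ik] := eqVneq i k.
  - by rewrite ag ik in ad.
  - by rewrite ag row.
  - by rewrite ik col.
  - exact: off.
move=> a b c [g k]; have [->|/eqP ad] := eqVneq a (g, k); last exact: main.
have [->|/eqP bd] := eqVneq b (g, k); last by rewrite T12 main.
have [->|/eqP cd] := eqVneq c (g, k); last by rewrite T23 T12 main.
have [h gh] := I2 g; have [l lk] := J2 k.
case: (Tcoef (g, k) (g, k)) => _ _ _ /(_ g h k l) /eqP.
have z u : u <> (g, k) -> T u (g, k) (g, k) u = 0.
  by move=> ud; rewrite T12 main// => /esym.
rewrite (z (h, l)) ?(z (g, l)) ?(z (h, k)) ?addr0; first by move=> /eqP.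
- by case=> /eqP; rewrite (negbTE gh).
- by case=> /eqP; rewrite (negbTE lk).
- by case=> /eqP; rewrite (negbTE gh).
Qed.

End Trilinear.

(** * Prolongations *)

(** Tangency at the rank one arrays s t, where s is e_a or e_a + e_b and t is e_i or
    e_i + e_k. As annihilators one takes another basis vector in the first case,
    and the difference e_a - e_b or e_i - e_k in the second. *)
Lemma lie_algebra_coef (R : realType) (p q : nat) (X : 'M[R]_(p * q)) :
  lie_algebra (SLSLH R p q) X ->
  segre_coef (fun a d => X (mxvec_index a.1 a.2) (mxvec_index d.1 d.2)).
Proof.
move=> gX.
pose x (a : 'I_p) (i : 'I_q) (g : 'I_p) (k : 'I_q) :=
  X (mxvec_index a i) (mxvec_index g k).
pose Q (phi : 'rV[R]_p) (psi : 'cV[R]_q) (s : 'cV[R]_p) (t : 'rV[R]_q) :=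
  (phi *m vec_mx (mxvec (s *m t) *m X) *m psi) 0 0.
pose er n (i : 'I_n) : 'rV[R]_n := delta_mx 0 i.
pose ec n (i : 'I_n) : 'cV[R]_n := delta_mx i 0.
have QE g k a i : Q (er _ g) (ec _ k) (ec _ a) (er _ i) = x a i g k.
  by rewrite /Q mul_delta_mx mxvec_delta -!rowE -colE !mxE.
have Q0 phi psi s t : phi *m s = 0 -> t *m psi = 0 -> Q phi psi s t = 0.
  by move=> h1 h2; rewrite /Q (lie_algebra_tangent gX)// mxE.
have QlB u v psi s t : Q (u - v) psi s t = Q u psi s t - Q v psi s t.
  by rewrite /Q !mulmxBl !mxE.
have QrB phi u v s t : Q phi (u - v) s t = Q phi u s t - Q phi v s t.
  by rewrite /Q !mulmxBr !mxE.
have QsD phi psi u v t : Q phi psi (u + v) t = Q phi psi u t + Q phi psi v t.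
  by rewrite /Q mulmxDl linearD mulmxDl linearD mulmxDr mulmxDl mxE.
have QtD phi psi s u v : Q phi psi s (u + v) = Q phi psi s u + Q phi psi s v.
  by rewrite /Q mulmxDr linearD mulmxDl linearD mulmxDr mulmxDl mxE.
have rc n (i j : 'I_n) : er n i *m ec n j = (i == j)%:R%:M.
  rewrite mul_delta_mx_cond; apply/matrixP => u v.
  by rewrite !ord1 !mxE eqxx/= mulr1n; case: eqP; rewrite !mxE.
have off n (i k : 'I_n) : i != k -> er n i *m ec n k = 0.
  by move=> ik; rewrite rc (negbTE ik) raddf0.
have x0 a i g k : a != g -> i != k -> x a i g k = 0.
  by move=> ag ik; rewrite -QE Q0 // off // eq_sym.
have dif n (i k : 'I_n) : i != k -> (er n i + er n k) *m (ec n i - ec n k) = 0.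
  move=> ik; rewrite mulmxDl !mulmxBr !rc !eqxx (negbTE ik) eq_sym (negbTE ik).
  by rewrite raddf0 subr0 sub0r subrr.
have dif' n (i k : 'I_n) : i != k -> (er n i - er n k) *m (ec n i + ec n k) = 0.
  move=> ik; rewrite mulmxDr !mulmxBl !rc !eqxx (negbTE ik) eq_sym (negbTE ik).
  by rewrite raddf0 subr0 sub0r subrr.
have x1 a g k l : a != g -> x a k g k = x a l g l.
  move=> ag; have [->//|kl] := eqVneq k l.
  have lk : l != k by rewrite eq_sym.
  have ga : g != a by rewrite eq_sym.
  have := Q0 _ _ _ _ (off _ _ _ ga) (dif _ _ _ kl).
  rewrite !(QtD, QrB) !QE (x0 a k g l)// (x0 a l g k)// subr0 sub0r => /eqP.
  by rewrite subr_eq0 => /eqP.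
have x2 a b i k : i != k -> x a i a k = x b i b k.
  move=> ik; have [->//|ab] := eqVneq a b.
  have ba : b != a by rewrite eq_sym.
  have := Q0 _ _ _ _ (dif' _ _ _ ab) (off _ _ _ ik).
  rewrite !(QsD, QlB) !QE (x0 a i b k)// (x0 b i a k)// subr0 sub0r => /eqP.
  by rewrite subr_eq0 => /eqP.
split=> [a g i k|a g k l|a b i k|a b i k] /=; [exact: x0|exact: x1|exact: x2|].
have [->|ab] := eqVneq a b; first by rewrite addrC.
have [->//|ik] := eqVneq i k.
have ba : b != a by rewrite eq_sym.
have ki : k != i by rewrite eq_sym.
have := Q0 _ _ _ _ (dif' _ _ _ ab) (dif _ _ _ ik).
rewrite !(QtD, QsD, QlB, QrB) !QE.
rewrite (x0 a i b k)// (x0 a k b i)// (x0 b i a k)// (x0 b k a i)//.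
rewrite (x1 a b i k)// (x1 b a i k)// (x2 a b i k)// (x2 a b k i)// => h.
by apply/eqP; rewrite -subr_eq0 -h; apply/eqP; rewrite /x; ring.
Qed.

Lemma multilinear_delta_eq0 (R : realType) (n k : nat)
    (T : ('I_k -> 'rV[R]_n) -> 'rV[R]_n) :
  multilinear T ->
  (forall f : 'I_k -> 'I_n, T (fun j => delta_mx 0 (f j)) = 0) ->
  T = cst 0.
Proof.
move=> Tlin T0; apply/funext => v /=.
(* Induction on the number [m] of arguments that are not yet basis vectors. *)
have H m w : (m <= k)%N ->
    (forall j : 'I_k, (m <= j)%N -> exists a, w j = delta_mx 0 a) -> T w = 0.
  elim: m w => [|m IH] w mk wd.
    have [f wf] := choice (fun j => wd j (leq0n _)).
    by rewrite (_ : w = fun j => delta_mx 0 (f j)) ?T0//; exact/funext.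
  pose i := Ordinal mk.
  have Ti a : T (replace_at w i (delta_mx 0 a)) = 0.
    apply: IH => [|j mj]; first exact: ltnW.
    rewrite /replace_at; case: eqVneq => [_|ji]; first by exists a.
    by apply: wd; rewrite ltn_neqAle mj andbT eq_sym; apply: contra ji.
  pose L := fun u => T (replace_at w i u).
  pose F : {linear 'rV[R]_n -> 'rV[R]_n} :=
    HB.pack L (GRing.isLinear.Build R _ _ _ L (Tlin i w)).
  have -> : w = replace_at w i (w i).
    by apply/funext => j; rewrite /replace_at; case: eqP => [->|].
  rewrite -[LHS]/(F (w i)) (row_sum_delta (w i)) linear_sum big1// => a _.
  by rewrite linearZ/= /L Ti scaler0.
by apply: (H k) => // j; rewrite leqNgt ltn_ord.
Qed.

Section Prolongations.
Variable R : realType.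

Definition args3 n (x y z : 'rV[R]_n) : 'I_3 -> 'rV[R]_n :=
  fun j => [:: x; y; z]`_j.

Lemma replace_args3 n (x y z u : 'rV[R]_n) :
  replace_at (args3 x y z) ord0 u = args3 u y z.
Proof. by apply/funext => -[[|[|[|]]]]. Qed.

Lemma second_prolongation_SLSLH p q :
  @prolongation R _ (lie_algebra (SLSLH R p.+2 q.+2)) 2 = [set cst 0].
Proof.
apply/seteqP; split=> [T [Tlin Tsym TG]|T ->]; last first.
  split=> // [i v a x y|v]; first by rewrite scaler0 addr0.
  rewrite (_ : lin1_mx _ = lin_mx (segre_inf 0 0)).
    exact: segre_inf_lie_algebra.
  congr lin1_mx; apply/funext => u /=.
  by rewrite /segre_inf mul0mx mulmx0 addr0 linear0.
pose e (a : 'I_p.+2 * 'I_q.+2) : 'rV[R]_(p.+2 * q.+2) :=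
  delta_mx 0 (mxvec_index a.1 a.2).
pose C a b c d := T (args3 (e a) (e b) (e c)) 0 (mxvec_index d.1 d.2).
have ord_other n (i : 'I_n.+2) : exists j, j != i.
  exists (if i == ord0 then ord_max else ord0).
  by case: (eqVneq i ord0) => [->|]//; rewrite eq_sym.
have T12 x y z : T (args3 x y z) = T (args3 y x z).
  rewrite -(Tsym (tperm ord0 (inord 1))); congr T; apply/funext => j /=.
  case: tpermP => [->|->|]; rewrite /args3 /= ?inordK//.
  case: j => -[|[|[|]]]//= ? /eqP; rewrite -val_eqE/= ?inordK// => _ /eqP.
  by rewrite -val_eqE/= inordK.
have T23 x y z : T (args3 x y z) = T (args3 x z y).
  rewrite -(Tsym (tperm (inord 1) (inord 2))); congr T; apply/funext => j /=.
  case: tpermP => [->|->|]; rewrite /args3 /= ?inordK//.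
  case: j => -[|[|[|]]]//= ? /eqP; rewrite -val_eqE/= ?inordK// => _ /eqP.
  by rewrite -val_eqE/= inordK.
have C0 : forall a b c d, C a b c d = 0.
  apply: (segre_coef_trilinear0 (@ord_other _) (@ord_other _)).
  - by move=> a b c d; rewrite /C T12.
  - by move=> a b c d; rewrite /C T23.
  - move=> b c; have := lie_algebra_coef (TG (args3 0 (e b) (e c))).
    rewrite (_ : (fun a d => _) = (fun a d => C a b c d))//.
    by apply/funext => a; apply/funext => d; rewrite mxE replace_args3.
rewrite /=; apply: (multilinear_delta_eq0 Tlin) => f.
apply/rowP => d; rewrite [RHS]mxE.
have fE j : exists a, delta_mx 0 (f j) = e a.
  by case/mxvec_indexP: (f j) => a b; exists (a, b).
have [a aE] := fE ord0; have [b bE] := fE (inord 1); have [c cE] := fE (inord 2).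
case/mxvec_indexP: d => d1 d2; rewrite -[RHS](C0 a b c (d1, d2)) /C /=.
congr (T _ _ _); apply/funext => j; rewrite /args3.
case: j => -[|[|[|]]]//= ?.
- by rewrite -aE; congr (delta_mx 0 (f _)); apply: val_inj.
- by rewrite -bE; congr (delta_mx 0 (f _)); apply: val_inj; rewrite /= inordK.
- by rewrite -cE; congr (delta_mx 0 (f _)); apply: val_inj; rewrite /= inordK.
Qed.

(** For fixed w the map z |-> z C w + w C z is X z + z Y with X = w C and Y = C w.
    With C = e_0 e_0 it is nonzero at z = w = e_0 e_0. *)
Lemma first_prolongation_SLSLH p q :
  @prolongation R _ (lie_algebra (SLSLH R p.+1 q.+1)) 1 <> [set cst 0].
Proof.
move=> H.
pose C : 'M[R]_(q.+1, p.+1) := delta_mx 0 0.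
pose b (x y : 'rV[R]_(p.+1 * q.+1)) :=
  mxvec (segre_inf (vec_mx y *m C) (C *m vec_mx y) (vec_mx x)).
pose T (v : 'I_2 -> 'rV[R]_(p.+1 * q.+1)) := b (v ord0) (v ord_max).
have bC x y : b x y = b y x.
  by rewrite /b /segre_inf [in LHS]addrC !mulmxA.
have blin y a x x' : b (a *: x + x') y = a *: b x y + b x' y.
  by rewrite /b !linearP.
have : @prolongation R _ (lie_algebra (SLSLH R p.+1 q.+1)) 1 T.
  split.
  - move=> i v a x y; rewrite /T /replace_at.
    have [->|->] : i = ord0 \/ i = ord_max.
      by case: i => -[|[|]]//= ?; [left|right]; apply: val_inj.
      by rewrite /= blin.
    by rewrite /= bC blin ![b _ (v ord0)]bC.
  - move=> s v; rewrite /T /=.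
    have two (i : 'I_2) : i = ord0 \/ i = ord_max.
      by case: i => -[|[|]]//= ?; [left|right]; apply: val_inj.
    have : s ord0 <> s ord_max by move/perm_inj.
    case: (two (s ord0)) => ->; case: (two (s ord_max)) => -> // _;
      by rewrite bC.
  - move=> v.
    pose w := vec_mx (v ord_max).
    exact: (segre_inf_lie_algebra (w *m C) (C *m w)).
rewrite H /= => T0.
pose E : 'M[R]_(p.+1, q.+1) := delta_mx 0 0.
have := congr1 (fun f => f (fun=> mxvec E)) T0.
rewrite /T /b /= mxvecK -[0](linear0 mxvec) => /(can_inj mxvecK).
move=> /matrixP/(_ 0 0); rewrite /segre_inf /E /C !mul_delta_mx !mxE !eqxx /=.
by move=> /eqP; rewrite -[_ + _]/(2%:R) pnatr_eq0.
Qed.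

End Prolongations.

(** * The G-structure of an almost Grassmann structure *)

Section Frames.
Variables (R : realType) (n : nat) (M : topologicalType).
Variable S : smooth_manifold R n M.
Implicit Types (e : 'I_n -> tvect R n M) (g h : 'M[R]_n).

Lemma change_frame_comb e g (c : 'rV[R]_n) :
  \sum_a c 0 a *: change_frame g e a = \sum_b (c *m g) 0 b *: e b.
Proof.
rewrite /change_frame; under eq_bigr do rewrite scaler_sumr.
rewrite exchange_big; apply: eq_bigr => b _; rewrite mxE scaler_suml.
by apply: eq_bigr => a _; rewrite scalerA.
Qed.

Lemma change_frameM e g h :
  change_frame g (change_frame h e) = change_frame (g *m h) e.
Proof.
apply/funext => a; rewrite [RHS]/change_frame.
transitivity (\sum_b (row a g) 0 b *: change_frame h e b).
  by apply: eq_bigr => b _; rewrite mxE.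
by rewrite change_frame_comb -row_mul; apply: eq_bigr => b _; rewrite mxE.
Qed.

Lemma change_frame1 e : change_frame 1%:M e = e.
Proof.
apply/funext => a; rewrite /change_frame (bigD1 a)//= mxE eqxx scale1r.
by rewrite big1 ?addr0// => b ba; rewrite mxE eq_sym (negbTE ba) scale0r.
Qed.

Lemma tangent_space_comb x e (c : 'I_n -> R) :
  (forall a, tangent_space S x (e a)) -> tangent_space S x (\sum_a c a *: e a).
Proof.
move=> te; have E phi : (\sum_a c a *: e a) phi = \sum_a c a *: e a phi.
  by rewrite fct_sumE.
split=> [phi nphi|phi psi hphi hpsi]; rewrite !E.
  by rewrite big1// => a _; rewrite (te a).1// scaler0.
rewrite mulmx_suml; apply: eq_bigr => a _.
by rewrite -scalemxAl -((te a).2 _ _ hphi hpsi).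
Qed.

Lemma change_frame_is_frame x e g h : g *m h = 1%:M -> h *m g = 1%:M ->
  is_frame S x e -> is_frame S x (change_frame g e).
Proof.
move=> gh hg [te e_basis]; split=> [a|v /e_basis[c [vE c_uniq]]].
  exact: tangent_space_comb.
exists (c *m h); split=> [|d]; rewrite change_frame_comb.
  by rewrite -mulmxA hg mulmx1.
by move=> /c_uniq ->; rewrite -mulmxA gh mulmx1.
Qed.

End Frames.

Section Adapted.
Variables (R : realType) (p q : nat) (M : topologicalType).
Variable S : smooth_manifold R (p * q) M.
Implicit Types (e : 'I_(p * q) -> tvect R (p * q) M).

Lemma segre_coneP e z : segre_cone e z <->
  exists (s : 'cV[R]_p) (t : 'rV[R]_q), z = \sum_a mxvec (s *m t) 0 a *: e a.
Proof.
have E (s : 'cV[R]_p) (t : 'rV[R]_q) : \sum_a mxvec (s *m t) 0 a *: e a =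
    \sum_alpha \sum_i (s alpha 0 * t 0 i) *: e (mxvec_index alpha i).
  rewrite pair_bigA (reindex _ (curry_mxvec_bij _ _)) /=.
  by apply: eq_bigr => -[a i] _ /=; rewrite mxvecE mxE big_ord1.
split=> [[t [s ->]]|[s [t ->]]].
  exists (\col_a t a), (\row_i s i); rewrite E.
  by do 2![apply: eq_bigr => ? _]; rewrite !mxE.
by exists (s ^~ 0), (t 0); rewrite E.
Qed.

Lemma segre_cone_SLSLH_sub e g : SLSLH R p q g ->
  segre_cone (change_frame g e) `<=` segre_cone e.
Proof.
move=> [A [B [c [_ _ _ gE]]]] z /segre_coneP[s [t ->]]; apply/segre_coneP.
exists (c *: (A *m s)), (t *m B); rewrite change_frame_comb gE.
rewrite -[lin_mx _]/(lin_mx (segre_act c A B)) mul_vec_lin /= /segre_act.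
by rewrite -scalemxAl !mulmxA.
Qed.

(** Equality follows from the inclusion, applied to the inverse change of frame. *)
Lemma segre_cone_SLSLH e g : SLSLH R p q g ->
  segre_cone (change_frame g e) = segre_cone e.
Proof.
move=> Gg; apply/seteqP; split; first exact: segre_cone_SLSLH_sub.
have [h [Gh _ hg]] := SLSLH_inv Gg.
by rewrite -{1}[e]change_frame1 -hg -change_frameM; exact: segre_cone_SLSLH_sub.
Qed.

End Adapted.

(** The orbits of one smooth adapted frame field around [x] form the
    G-structure. *)
Lemma underlying_G_structure (R : realType) (p q : nat) (M : topologicalType)
    (S : smooth_manifold R (p * q) M) (AG : almost_grassmann S) (x : M) :
  exists U : set M, U x /\
    exists P : G_structure S (SLSLH R p q) U, underlies AG P.
Proof.
have [U [oU Ux [e e_smooth e_adapted]]] := SC_local AG x.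
exists U; split=> //.
pose F y := [set change_frame g (e y) | g in SLSLH R p q].
have F_frame y f : U y -> F y f -> is_frame S y f.
  move=> Uy [g Gg <-]; have [h [_ gh hg]] := SLSLH_inv Gg.
  exact: change_frame_is_frame gh hg (e_smooth.1 y Uy).
have F_orbit y f : U y -> F y f ->
    F y = [set change_frame g f | g in SLSLH R p q].
  move=> Uy [g Gg <-]; have [h [Gh gh hg]] := SLSLH_inv Gg.
  apply/seteqP; split=> [_ [k Gk <-]|_ [k Gk <-]].
    exists (k *m h); first exact: SLSLHM.
    by rewrite change_frameM -mulmxA hg mulmx1.
  by exists (k *m g); [exact: SLSLHM|rewrite change_frameM].
have F_section y : U y -> exists W : set M, [/\ open W, W y, W `<=` U &
    exists2 f, smooth_frame_field S W f & forall z, W z -> F z (f z)].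
  move=> Uy; exists U; split=> //; exists e => // z Uz.
  by exists 1%:M; [exact: SLSLH1|exact: change_frame1].
exists (GStructure oU F_frame F_orbit F_section) => y _ Uy [g Gg <-].
split; first by apply: F_frame => //; exists g.
by rewrite segre_cone_SLSLH// (e_adapted y Uy).2.
Qed.

Theorem theorem4p1 (R : realType) (p q : nat) (hp : (2 <= p)%N) (hq : (2 <= q)%N)
    (M : topologicalType) (S : smooth_manifold R (p * q) M)
    (AG : almost_grassmann S) :
  (forall x : M, exists U : set M, U x /\
     exists P : G_structure S (SLSLH R p q) U, underlies AG P) /\
  (forall (U : set M) (P : G_structure S (SLSLH R p q) U),
     underlies AG P -> G_structure_of_finite_type P 2).
Proof.
split=> [x|U P _]; first exact: underlying_G_structure.
case: p hp S AG U P => [|[|p]]// _ S AG U P.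
case: q hq S AG U P => [|[|q]]// _ S AG U P.
split; first exact: second_prolongation_SLSLH.
exact: first_prolongation_SLSLH.
Qed.
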